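(* Let $A\subseteq\mathbb{R}_1^2$ be a compact and path connected subset. Then the double hatching $L(A)$, with the metric induced from $\mathbb{R}_1^2$, is isometric to the tight span $T(A)$ of $A$, where $A$ carries the metric induced from $\mathbb{R}_1^2$.
   Context: The Manhattan plane is $\mathbb{R}_1^2=(\mathbb{R}^2,d_1)$ with $d_1((x_1,y_1),(x_2,y_2))=|x_1-x_2|+|y_1-y_2|$. Path connected sets are understood to be nonempty. Hatching: for $A\subseteq\mathbb{R}_1^2$ and $x,y\in\mathbb{R}$ let $A_x=\{(p_1,p_2)\in A : p_1=x\}$ and $A^y=\{(p_1,p_2)\in A : p_2=y\}$. For a subset $X$ of a horizontal or vertical line, $[X]$ denotes the minimal segment (possibly infinite or empty, not necessarily closed) containing $X$ and contained in the same line, i.e. the convex hull of $X$. Define $L_x(A)=\bigcup_{y\in\mathbb{R}}[A^y]$ and $L_y(A)=\bigcup_{x\in\mathbb{R}}[A_x]$. For path connected $A$ one has $L_x(L_y(A))=L_y(L_x(A))$, and the double hatching of $A$ is $L(A)=L_x(L_y(A))=L_y(L_x(A))$. Tight span: for a metric space $(X,d)$, $T(X)$ is the set of pointwise minimal functions among all functions $f:X\to\mathbb{R}^{\geq 0}$ satisfying $f(x)+f(y)\geq d(x,y)$ for all $x,y\in X$ (minimal means: if $g:X\to\mathbb{R}^{\ge 0}$ satisfies the same inequalities and $g\leq f$ pointwise, then $g=f$), with the supremum metric $d_\infty(f,g)=\sup_{x\in X}|f(x)-g(x)|$. *)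

(* Defs.v *)
From HB Require Import structures.
From mathcomp Require Import all_boot all_order all_algebra.
From mathcomp Require Import all_classical all_reals all_analysis.
From mathcomp Require Import lra.

Set Implicit Arguments.
Unset Strict Implicit.
Unset Printing Implicit Defensive.

Import Order.TTheory GRing.Theory Num.Theory.
Import numFieldNormedType.Exports.

Local Open Scope classical_set_scope.
Local Open Scope ring_scope.

(* An alias of R * R: it must not inherit the sup metric that the library puts
   on products. *)
Definition manhattan (R : realType) : Type := (R * R)%type.

Section ManhattanPlane.
Context {R : realType}.
Implicit Types p q r : manhattan R.

Definition manhattan_dist p q : R := `|p.1 - q.1| + `|p.2 - q.2|.

Lemma manhattan_distxx p : manhattan_dist p p = 0.
Proof. by rewrite /manhattan_dist !subrr normr0 addr0. Qed.

Lemma manhattan_dist_positivity p q : manhattan_dist p q = 0 -> p = q.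
Proof.
move=> /eqP; rewrite /manhattan_dist paddr_eq0// !normr_eq0 !subr_eq0.
by case: p q => [? ?] [? ?] /= /andP[/eqP-> /eqP->].
Qed.

Lemma manhattan_dist_sym p q : manhattan_dist p q = manhattan_dist q p.
Proof. by congr +%R; exact: distrC. Qed.

Lemma manhattan_dist_triangle q p r :
  manhattan_dist p r <= manhattan_dist p q + manhattan_dist q r.
Proof. by rewrite /manhattan_dist addrACA lerD// ler_distD. Qed.

HB.instance Definition _ := Choice.on (manhattan R).

HB.instance Definition _ := isMetric.Build R (manhattan R)
  manhattan_distxx manhattan_dist_positivity manhattan_dist_sym
  manhattan_dist_triangle.

End ManhattanPlane.

(* Makes every subset of a metric space, seen as a type, a metric space with
   the induced metric. *)
Section InducedMetric.
Context {R : realType} {X : metricType R} (A : set X).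
Implicit Types x y : set_type A.

Definition induced_dist x y : R := mdist (set_val x) (set_val y).

Lemma induced_dist_ge0 x y : 0 <= induced_dist x y.
Proof. exact: mdist_ge0. Qed.

Lemma induced_dist_positivity x y : induced_dist x y = 0 -> x = y.
Proof. by move=> /mdist_positivity; exact: val_inj. Qed.

Lemma ballE_induced_dist x e : ball x e = [set y | induced_dist x y < e].
Proof.
apply/seteqP; split => y /=.
- by rewrite -initial_ballE /preimage/= ballEmdist.
- by rewrite -initial_ballE /preimage/= ballEmdist.
Qed.

HB.instance Definition _ := PseudoMetric_isMetric.Build R (set_type A)
  induced_dist_ge0 induced_dist_positivity ballE_induced_dist.

End InducedMetric.

Definition isometric {R : realType} (X Y : metricType R) : Prop :=
  exists2 f : X -> Y, bijective f & forall x y, mdist (f x) (f y) = mdist x y.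

(* Path connected sets are nonempty by convention. *)
Definition path_connected {R : realType} {X : metricType R} (A : set X) :
    Prop :=
  A !=set0 /\ forall x y, A x -> A y ->
    exists gamma : R -> X,
      [/\ {within `[0, 1], continuous gamma}, gamma 0 = x, gamma 1 = y &
          gamma @` `[0, 1] `<=` A].

Section Hatching.
Context {R : realType}.
Implicit Types A X : set (manhattan R).

(* Only applied to subsets of horizontal and vertical lines, where it is the
   smallest (possibly empty or non-closed) segment of the line containing X. *)
Definition convex_hull X : set (manhattan R) :=
  smallest (@convex_set R (R^o * R^o)%type) X.

Definition vertical_slice A (x : R) : set (manhattan R) :=
  [set p | A p /\ p.1 = x].
Definition horizontal_slice A (y : R) : set (manhattan R) :=
  [set p | A p /\ p.2 = y].

Definition hatching_x A : set (manhattan R) :=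
  \bigcup_y convex_hull (horizontal_slice A y).
Definition hatching_y A : set (manhattan R) :=
  \bigcup_x convex_hull (vertical_slice A x).

(* For path connected A the two orders of composition agree. *)
Definition double_hatching A : set (manhattan R) := hatching_x (hatching_y A).

End Hatching.

Section TightSpan.
Context {R : realType} {X : metricType R}.
Implicit Types f g h : X -> R.

Definition admissible f : Prop :=
  (forall x, 0 <= f x) /\ (forall x y, mdist x y <= f x + f y).

Definition extremal f : Prop :=
  admissible f /\
  forall g, admissible g -> (forall x, g x <= f x) -> g = f.

Lemma extremal_lipschitz f x y : extremal f -> f x <= f y + mdist x y.
Proof.
move=> [[f0 fd] fmin]; rewrite leNgt; apply/negP => ltf.
pose c := f y + mdist x y.
have c0 : 0 <= c by rewrite addr_ge0// mdist_ge0.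
have dc z : mdist x z <= c + f z.
  have := metric_triangle x y z; have := fd y z; rewrite /c; lra.
pose g z := if z == x then c else f z.
have gf : g = f.
  apply: fmin => [|z]; last by rewrite /g; case: eqP => [->|//]; exact: ltW.
  split=> [z|z w]; first by rewrite /g; case: ifP.
  rewrite /g; case: eqP => [->|_]; case: eqP => [->|_] //.
  - by rewrite mdistxx addr_ge0.
  - by rewrite addrC metric_sym.
by move: ltf; rewrite -[in X in _ < X]gf /g eqxx ltxx.
Qed.

Lemma extremal_dist_bound f g x0 x : extremal f -> extremal g ->
  `|f x - g x| <= f x0 + g x0.
Proof.
move=> ef eg; have := extremal_lipschitz x x0 ef.
have := extremal_lipschitz x x0 eg.
case: ef eg => [[_ /(_ x x0) fd] _] [[_ /(_ x x0) gd] _].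
rewrite ler_norml; lra.
Qed.

End TightSpan.

(* An alias of the subtype of extremal functions, so that it gets no topology
   other than the one of tight_span_dist. *)
Definition tight_span {R : realType} (X : metricType R) : Type :=
  set_type [set f : X -> R | extremal f].

Section TightSpanMetric.
Context {R : realType} {X : metricType R}.
Implicit Types f g h : tight_span X.

(* By extremal_dist_bound, this is the supremum of a bounded set. *)
Definition tight_span_dist f g : R :=
  sup [set `|set_val f x - set_val g x| | x in [set: X]].

Lemma tight_span_extremal f : extremal (set_val f).
Proof. exact: (set_mem (valP f)). Qed.

Lemma tight_span_dist_ub f g x :
  `|set_val f x - set_val g x| <= tight_span_dist f g.
Proof.
apply: ub_le_sup; last by exists x.
exists (set_val f x + set_val g x) => _ [y _ <-].
exact: extremal_dist_bound (tight_span_extremal f) (tight_span_extremal g).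
Qed.

Lemma tight_span_dist_le f g M : 0 <= M ->
  (forall x, `|set_val f x - set_val g x| <= M) -> tight_span_dist f g <= M.
Proof.
move=> M0 fgM; rewrite /tight_span_dist.
have [[x _]|nX] := pselect (exists x : X, True).
  apply: ge_sup; first by exists `|set_val f x - set_val g x|; exists x.
  by move=> _ [y _ <-].
rewrite (_ : image _ _ = set0) ?sup0// -subset0 => r [x _ _].
by case: nX; exists x.
Qed.

Lemma tight_span_dist_ge0 f g : 0 <= tight_span_dist f g.
Proof.
rewrite /tight_span_dist; have [[x _]|nX] := pselect (exists x : X, True).
  exact: le_trans (tight_span_dist_ub f g x).
rewrite (_ : image _ _ = set0) ?sup0// -subset0 => r [x _ _].
by case: nX; exists x.
Qed.

Lemma tight_span_distxx f : tight_span_dist f f = 0.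
Proof.
apply/eqP; rewrite eq_le tight_span_dist_ge0 andbT.
by apply: tight_span_dist_le => // x; rewrite subrr normr0.
Qed.

Lemma tight_span_dist_positivity f g : tight_span_dist f g = 0 -> f = g.
Proof.
move=> d0; apply: val_inj; apply/funext => x; apply/eqP.
by have := tight_span_dist_ub f g x; rewrite d0 normr_le0 subr_eq0.
Qed.

Lemma tight_span_dist_sym f g : tight_span_dist f g = tight_span_dist g f.
Proof. by congr sup; apply: eq_imagel => x _; exact: distrC. Qed.

Lemma tight_span_dist_triangle g f h :
  tight_span_dist f h <= tight_span_dist f g + tight_span_dist g h.
Proof.
apply: tight_span_dist_le => [|x]; first by rewrite addr_ge0// tight_span_dist_ge0.
by rewrite (le_trans (ler_distD (set_val g x) _ _))// lerD// tight_span_dist_ub.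
Qed.

HB.instance Definition _ := Choice.on (tight_span X).

HB.instance Definition _ := isMetric.Build R (tight_span X)
  tight_span_distxx tight_span_dist_positivity tight_span_dist_sym
  tight_span_dist_triangle.

End TightSpanMetric.

(* Main.v *)
(* Write d_p for the function a |-> d_1(p, a) on A. The double hatching of A
   consists of the points p all of whose closed quadrants meet A, by the
   intermediate value theorem along paths in A. For such a p, every point a has
   an opposite b in A, meaning that d_1(a, b) = d_1(a, p) + d_1(p, b); this makes
   d_p extremal and p |-> d_p isometric. Conversely, for f extremal the balls of
   radius f(a) around a meet pairwise, hence (the plane being injective) share
   a point p, and f = d_p by minimality. Compactness of A gives every a an
   opposite b with respect to p, which forces all quadrants of p to meet the
   path connected set A. *)
Require Import Defs.
From mathcomp Require Import all_boot all_order all_algebra.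
From mathcomp Require Import all_classical all_reals all_analysis.
From mathcomp Require Import ring lra.

Set Implicit Arguments.
Unset Strict Implicit.
Unset Printing Implicit Defensive.

Import Order.TTheory GRing.Theory Num.Theory.
Import numFieldNormedType.Exports.

Local Open Scope classical_set_scope.
Local Open Scope ring_scope.

(** * Lipschitz continuity and intermediate values along paths *)

Section MetricSpaces.
Context {R : realType} {X : metricType R}.
Implicit Types (A : set X) (h : X -> R) (p x y : X).

Lemma lipschitz_mdist_continuous h (k : R) : 0 < k ->
  (forall x y, `|h x - h y| <= k * mdist x y) -> continuous h.
Proof.
move=> k0 hk x; apply/cvgrPdist_lt => e e0.
have ek0 : 0 < e / k by rewrite divr_gt0.
apply: filterS (nbhsx_ballx x _ ek0) => y.
rewrite ballEmdist /= ltr_pdivlMr// mulrC; exact: le_lt_trans.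
Qed.

Lemma mdist_lipschitz p x y : `|mdist p x - mdist p y| <= mdist x y.
Proof.
rewrite ler_norml; have := metric_triangle p y x; have := metric_triangle p x y.
rewrite (metric_sym y x); lra.
Qed.

Lemma path_connected_IVT A h a b : path_connected A -> continuous h ->
  A a -> A b -> h a <= 0 -> 0 <= h b -> exists2 c, A c & h c = 0.
Proof.
move=> [_ pcA] hc Aa Ab ha hb.
have [gamma [gc g0 g1 gA]] := pcA _ _ Aa Ab.
have hgc : {within `[0, 1], continuous (h \o gamma)}.
  by apply: within_continuous_comp => // x _; exact: hc.
have [|t t01 ht] := IVT (ler01 : (0 : R) <= 1) hgc (v := 0).
  by rewrite /= g0 g1 ge_min ha le_max hb orbT.
by exists (gamma t) => //; apply: gA; exists t.
Qed.

End MetricSpaces.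

(** * Quadrants and opposite points *)

Section Quadrants.
Context {R : realType}.
Implicit Types (A : set (manhattan R)) (p q a b : manhattan R) (s t : bool).

(* The closed quadrant with apex p; the booleans are the signs of the
   coordinates, true standing for -1. *)
Definition quadrant s t p : set (manhattan R) :=
  [set a | 0 <= (-1) ^+ s * (a.1 - p.1) /\ 0 <= (-1) ^+ t * (a.2 - p.2)].

Definition surrounded A p := forall s t, A `&` quadrant s t p !=set0.

Lemma mdist_manhattanE p q : mdist p q = `|p.1 - q.1| + `|p.2 - q.2|.
Proof. by []. Qed.

Lemma quadrant_cover p a : exists s t, quadrant s t p a.
Proof.
have H (x : R) : exists s, 0 <= (-1) ^+ s * x.
  by exists (x < 0); rewrite -normrEsign.
have [s hs] := H (a.1 - p.1); have [t ht] := H (a.2 - p.2).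
by exists s, t.
Qed.

Lemma normr_split s (x y z : R) : 0 <= (-1) ^+ s * (x - y) ->
  0 <= (-1) ^+ (~~ s) * (z - y) -> `|x - z| = `|x - y| + `|y - z|.
Proof.
by case: s; rewrite /= expr0 expr1 => h1 h2;
  [rewrite !ler0_norm|rewrite !ger0_norm]; lra.
Qed.

(** In each coordinate [p] separates [a] from [b], so both absolute values split. *)
Lemma quadrant_opposite s t p a b : quadrant s t p a ->
  quadrant (~~ s) (~~ t) p b -> mdist a b = mdist a p + mdist p b.
Proof.
move=> [a1 a2] [b1 b2]; rewrite !mdist_manhattanE.
by rewrite (normr_split a1 b1) (normr_split a2 b2) addrACA.
Qed.

Lemma surrounded_opposite A p a : surrounded A p ->
  exists2 b, A b & mdist a b = mdist a p + mdist p b.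
Proof.
move=> Ap; have [s [t pa]] := quadrant_cover p a.
have [b [Ab pb]] := Ap (~~ s) (~~ t).
by exists b => //; exact: quadrant_opposite pa pb.
Qed.


(** * Linear forms, convex hulls and the double hatching *)

Lemma linear_form_continuous (u v w : R) :
  continuous (fun q : manhattan R => u * q.1 + v * q.2 + w).
Proof.
(* The summand [1] keeps the Lipschitz constant positive when [u] and [v] vanish. *)
apply: (@lipschitz_mdist_continuous _ _ _ (`|u| + `|v| + 1)) => [|p q].
  by rewrite ltr_wpDl// addr_ge0.
rewrite mdist_manhattanE (_ : _ - _ = u * (p.1 - q.1) + v * (p.2 - q.2)); last by lra.
rewrite (le_trans (ler_normD _ _))// !normrM.
have := normr_ge0 u; have := normr_ge0 v.
have := normr_ge0 (p.1 - q.1); have := normr_ge0 (p.2 - q.2); nra.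
Qed.

Lemma convex_hull_segment (X : set (manhattan R)) a b p (t : R) : X a -> X b ->
  0 <= t <= 1 -> p.1 = t * a.1 + (1 - t) * b.1 ->
  p.2 = t * a.2 + (1 - t) * b.2 -> convex_hull X p.
Proof.
move=> Xa Xb /andP[t0 t1] p1 p2 C [cC XC].
have := cC a b (Itv01 t0 t1) (mem_set (XC _ Xa)) (mem_set (XC _ Xb)).
by rewrite inE; congr C; case: p p1 p2 => x y /= -> ->.
Qed.

Lemma between_convex_combination (x y z : R) : x <= y <= z ->
  exists2 t, 0 <= t <= 1 & y = t * x + (1 - t) * z.
Proof.
move=> /andP[xy yz]; have [xz|xz] := eqVneq x z.
  by exists 0; rewrite ?lexx ?ler01//; lra.
have xz0 : 0 < z - x by rewrite subr_gt0 lt_neqAle xz (le_trans xy).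
exists ((z - y) / (z - x)).
  by rewrite divr_ge0 ?ler_pdivrMr//=; lra.
by field; lra.
Qed.

(* Otherwise X lies in an open half-plane that misses p. *)
Lemma convex_hull_linear_form_le (X : set (manhattan R)) p (u v : R) :
  convex_hull X p -> exists2 a, X a & u * a.1 + v * a.2 <= u * p.1 + v * p.2.
Proof.
move=> Xp; apply: contrapT => nX.
pose H : set (manhattan R) := [set a | u * p.1 + v * p.2 < u * a.1 + v * a.2].
suff : H p by rewrite /H /= ltxx.
apply: Xp; split=> [|a Xa]; last first.
  by rewrite /H /= ltNge; apply/negP => ap; apply: nX; exists a.
apply/convex_setW => a b; rewrite !inE => ap bp k k0 k1; apply/mem_set.
change (u * p.1 + v * p.2 < u * (k%:num * a.1 + (1 - k%:num) * b.1)
  + v * (k%:num * a.2 + (1 - k%:num) * b.2)).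
move: (k%:num) k0 k1 ap bp => l l0 l1; rewrite /H /=; nra.
Qed.

(** Linear forms pick first a vertically hatched point on the row of [p] on side [s], then a point
    of [A] in its column on side [t]. *)
Lemma double_hatching_surrounded A p : double_hatching A p -> surrounded A p.
Proof.
move=> [y _ hp] s t.
(* Testing a coordinate and its negative shows that the hull stays on its line. *)
have p2 : p.2 = y.
  have [a [_ ay] ap] := convex_hull_linear_form_le 0 1 hp.
  have [b [_ by_] bp] := convex_hull_linear_form_le 0 (-1) hp.
  by apply/eqP; rewrite eq_le; lra.
have [a [[x _ ha] ay] ap] := convex_hull_linear_form_le (- (-1) ^+ s) 0 hp.
have a1 : a.1 = x.
  have [c [_ cx] ca] := convex_hull_linear_form_le 1 0 ha.
  have [b [_ bx] ba] := convex_hull_linear_form_le (-1) 0 ha.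
  by apply/eqP; rewrite eq_le; lra.
have [b [Ab bx] ba] := convex_hull_linear_form_le 0 (- (-1) ^+ t) ha.
exists b; split=> //; split.
- by rewrite bx -a1; lra.
- by rewrite p2 -ay; lra.
Qed.

(* A path from a to b within A either crosses the horizontal line through p on
   the far side of b, or meets the vertical line through b beforehand. *)
Lemma quadrants_share_column_outward A p s t a b : path_connected A ->
  A a -> A b -> quadrant s t p a -> quadrant s (~~ t) p b ->
  (-1) ^+ s * b.1 <= (-1) ^+ s * a.1 ->
  exists c d, [/\ A c, A d, quadrant s t p c, quadrant s (~~ t) p d & c.1 = d.1].
Proof.
move=> pcA Aa Ab [a1 a2] [b1 b2] ab.
(* [f q <= 0] says that [q] is at least as far out as [b], and [g q <= 0] that [q] lies on side [t]
   of [p]. A zero of the maximum is in the column of [b] or on the row of [p]. *)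
pose f q : R := - (-1) ^+ s * q.1 + 0 * q.2 + (-1) ^+ s * b.1.
pose g q : R := 0 * q.1 + - (-1) ^+ t * q.2 + (-1) ^+ t * p.2.
have hc : continuous (f \max g).
  by move=> q; apply: continuous_max; exact: linear_form_continuous.
have [||c Ac /eqP] := path_connected_IVT pcA hc Aa Ab.
- by rewrite /= /f /g ge_max; apply/andP; split; lra.
- rewrite /= /f /g le_max; apply/orP; left; lra.
rewrite /f /g /= eq_le ge_max le_max => /andP[/andP[fc gc] /orP[fc0|gc0]].
- exists c, b; split=> //; first by split; [move: b1|]; lra.
  by case: s fc fc0 {f g hc a1 b1 ab} => /=; rewrite ?expr0 ?expr1; lra.
- by exists c, c; split=> //; split; rewrite ?signrN; lra.
Qed.

(** Of two points of [A] in the quadrants on side [s], the path starts at the one further out. *)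
Lemma quadrants_share_column A p s : path_connected A -> surrounded A p ->
  exists x, 0 <= (-1) ^+ s * (x - p.1) /\
    forall t, exists2 a, A a & a.1 = x /\ 0 <= (-1) ^+ t * (a.2 - p.2).
Proof.
move=> pcA Ap.
suff [t [c [d [Ac Ad [c1 c2] [d1 d2] cd]]]] : exists t c d,
    [/\ A c, A d, quadrant s t p c, quadrant s (~~ t) p d & c.1 = d.1].
  exists c.1; split=> // t'.
  case: t t' c2 d2 => [] [] c2 d2; by [exists c|exists d].
have [a [Aa pa]] := Ap s false; have [b [Ab pb]] := Ap s true.
have [ab|/ltW ab] := leP ((-1) ^+ s * b.1) ((-1) ^+ s * a.1).
- by exists false; exact: quadrants_share_column_outward pa pb ab.
- by exists true; exact: quadrants_share_column_outward pb pa ab.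
Qed.

(** On each side of [p] a shared column gives a vertically hatched point on the row of [p];
    horizontal hatching between the two reaches [p]. *)
Lemma surrounded_double_hatching A p :
  path_connected A -> surrounded A p -> double_hatching A p.
Proof.
move=> pcA Ap.
have column s : exists2 x, 0 <= (-1) ^+ s * (x - p.1) & hatching_y A (x, p.2).
  have [x [px Ax]] := quadrants_share_column s pcA Ap; exists x => //.
  have [a Aa [ax a2]] := Ax true; have [b Ab [bx b2]] := Ax false.
  have [|t t01 pt] := @between_convex_combination a.2 p.2 b.2.
    by move: a2 b2; rewrite expr0 expr1; lra.
  exists x => //; apply: (@convex_hull_segment _ a b _ t) => //=.
  by rewrite ax bx; lra.
have [x px Ax] := column true; have [y py Ay] := column false.
have [|t t01 pt] := @between_convex_combination x p.1 y.
  by move: px py; rewrite expr0 expr1; lra.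
exists p.2 => //; apply: (@convex_hull_segment _ (x, p.2) (y, p.2) _ t) => //=.
by lra.
Qed.

(** Equality in the sum forces equality in both coordinatewise triangle inequalities; squaring these
    gives the signs. *)
Lemma mdist_split_coordinates a b p : mdist a b = mdist a p + mdist p b ->
  (a.1 - p.1) * (b.1 - p.1) <= 0 /\ (a.2 - p.2) * (b.2 - p.2) <= 0.
Proof.
rewrite !mdist_manhattanE => ab.
have h1 := ler_distD p.1 a.1 b.1; have h2 := ler_distD p.2 a.2 b.2.
have H (x y z : R) : `|x - z| = `|x - y| + `|y - z| -> (x - y) * (z - y) <= 0.
  move=> /(congr1 (fun r => r ^+ 2)); rewrite sqrrD !real_normK ?num_real//.
  by rewrite -normrM; have := normr_ge0 ((x - y) * (y - z)); nra.
by split; apply: H; lra.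
Qed.

End Quadrants.

(** * Injectivity of the Manhattan plane *)

Section Injectivity.
Context {R : realType} {I : Type}.
Implicit Types (f : I -> R).

(* Helly in dimension one; z is the supremum of the left endpoints. *)
Lemma intervals_common_point f (x : I -> R) (i0 : I) :
  (forall i j, `|x i - x j| <= f i + f j) -> exists z, forall i, `|z - x i| <= f i.
Proof.
move=> xf.
have ub j : ubound (range (fun i => x i - f i)) (x j + f j).
  by move=> _ [i _ <-]; have := xf i j; rewrite ler_norml; lra.
exists (sup (range (fun i => x i - f i))) => i.
have lo : x i - f i <= sup (range (fun i => x i - f i)).
  by apply: ub_le_sup; [exists (x i0 + f i0); exact: ub|exists i].
have hi : sup (range (fun i => x i - f i)) <= x i + f i.
  by apply: ge_sup; [exists (x i0 - f i0); exists i0|exact: ub].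
by rewrite ler_norml; lra.
Qed.

(* x + y and x - y turn d_1 into the supremum metric, whose balls are products
   of intervals. *)
Lemma manhattan_balls_common_point f (c : I -> manhattan R) (i0 : I) :
  (forall i j, mdist (c i) (c j) <= f i + f j) ->
  exists p, forall i, mdist p (c i) <= f i.
Proof.
move=> cf.
have H (x y z : R) : `|x| + `|y| <= z -> `|x + y| <= z /\ `|x - y| <= z.
  move=> xyz; split; first exact: le_trans (ler_normD _ _) xyz.
  exact: le_trans (ler_normB _ _) xyz.
have [|u hu] := @intervals_common_point f (fun i => (c i).1 + (c i).2) i0.
  move=> i j; have [+ _] := H _ _ _ (cf i j).
  by congr (`|_| <= _); lra.
have [|v hv] := @intervals_common_point f (fun i => (c i).1 - (c i).2) i0.
  move=> i j; have [_] := H _ _ _ (cf i j).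
  by congr (`|_| <= _); lra.
exists ((u + v) / 2, (u - v) / 2) => i; rewrite mdist_manhattanE /=.
have := hu i; have := hv i; rewrite !ler_norml.
by case: (ger0P ((u + v) / 2 - _)); case: (ger0P ((u - v) / 2 - _)); lra.
Qed.

End Injectivity.

(** * Extremal distance functions and opposite points *)

Section DistanceFunctions.
Context {R : realType} {X : metricType R} (A : set X).
Implicit Types (p a b : X).

Definition distance_to p : set_type A -> R :=
  fun x => mdist p (set_val x).

Lemma distance_to_admissible p : admissible (distance_to p).
Proof.
split=> [x|x y]; first exact: mdist_ge0.
rewrite /distance_to (metric_sym p (set_val x)).
exact: (metric_triangle (set_val x) p).
Qed.

(** An admissible [g] below the distance function satisfies [mdist a b <= g a + g b <= g a + mdist p
    b], so an opposite [b] bounds [g a] below by [mdist a p]. *)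
Lemma distance_to_extremal p :
  (forall a, A a -> exists2 b, A b & mdist a b = mdist a p + mdist p b) ->
  extremal (distance_to p).
Proof.
move=> hp; split=> [|g [_ gd] gp]; first exact: distance_to_admissible.
apply/funext => a; apply/eqP; rewrite eq_le gp /=.
have [b Ab abE] := hp _ (set_mem (valP a)).
have := gd a (exist _ b (mem_set Ab)); have := gp (exist _ b (mem_set Ab)).
rewrite /distance_to (metric_sym p (set_val a)).
change (mdist a (exist _ b (mem_set Ab))) with (mdist (set_val a) b).
rewrite abE /=; lra.
Qed.

(** Compactness gives a [b] of least slack [m] in the triangle inequality through [p]. If [m] were
    positive, lowering the distance function at [a] by [m / 2] would contradict minimality. *)
Lemma extremal_distance_to_opposite p a : compact A ->
  extremal (distance_to p) -> A a ->
  exists2 b, A b & mdist a b = mdist a p + mdist p b.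
Proof.
move=> cptA [_ minp] Aa.
pose F b := mdist p b - mdist a b.
have Fc : continuous F.
  apply: (@lipschitz_mdist_continuous _ _ _ 2) => // x y.
  have := mdist_lipschitz p x y; have := mdist_lipschitz a x y.
  rewrite !ler_norml /F; lra.
have [||b bA Fmin] := @compact_EVT_min _ _ F A _ cptA.
- by exists a.
- exact: continuous_subspaceT.
exists b; first exact: set_mem.
apply: contrapT => abp.
pose m := mdist a p + F b.
have m0 : 0 < m.
  have := metric_triangle a p b; rewrite /m /F => tri.
  rewrite lt_neqAle; apply/andP; split; last by lra.
  by apply/eqP => m0; apply: abp; lra.
have Fm c : A c -> mdist a c + m <= mdist a p + mdist p c.
  by move=> /mem_set/Fmin; rewrite /m /F; lra.
(* The slack at [a] itself is [2 * mdist p a], so the lowered value stays nonnegative. *)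
have ap : m <= 2 * mdist p a.
  by have := Fm _ Aa; rewrite mdistxx (metric_sym p); lra.
pose a' : set_type A := exist _ a (mem_set Aa).
pose g c := if c == a' then mdist p a - m / 2 else distance_to p c.
suff gp : g = distance_to p.
  have /eqP := congr1 (fun k => k a') gp; rewrite /g eqxx /distance_to /=; lra.
apply: minp => [|c]; last first.
  by rewrite /g; case: eqP => [->|//]; rewrite /distance_to /=; lra.
split=> [c|c d]; rewrite /g.
  case: eqP => _; [lra|exact: mdist_ge0].
have dE (x y : set_type A) : mdist x y = mdist (set_val x) (set_val y) by [].
case: eqP => [->|_]; case: eqP => [->|_].
- by rewrite mdistxx; lra.
- by have := Fm _ (set_mem (valP d)); rewrite dE /distance_to /= (metric_sym p a); lra.
- have := Fm _ (set_mem (valP c)).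
  by rewrite metric_sym dE /distance_to /= (metric_sym p a); lra.
- exact: (distance_to_admissible p).2.
Qed.

End DistanceFunctions.

Arguments distance_to {R X} A p _.

(** * Extremal functions as distances to surrounded points *)

Section ManhattanTightSpan.
Context {R : realType} (A : set (manhattan R)).
Context (cptA : compact A) (pcA : path_connected A).
Implicit Types p q : manhattan R.

(* In coordinates X, Y centred at p and signed so that the missed quadrant is
   [X, Y >= 0], opposite points of A lie on different sides of the line X = Y.
   So A meets this line, where X = Y < 0, and the opposite of such a point would
   lie in the missed quadrant. *)
Lemma extremal_surrounded p :
  extremal (distance_to A p) -> surrounded A p.
Proof.
move=> ep s t; apply: contrapT => missed.
have opp a : A a -> exists2 b, A b &
   ((-1) ^+ s * (a.1 - p.1)) * ((-1) ^+ s * (b.1 - p.1)) <= 0 /\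
   ((-1) ^+ t * (a.2 - p.2)) * ((-1) ^+ t * (b.2 - p.2)) <= 0.
  move=> Aa; have [b Ab abE] := extremal_distance_to_opposite cptA ep Aa.
  exists b => //; do 2 rewrite mulrACA -expr2 sqrr_sign mul1r.
  exact: mdist_split_coordinates.
have out a : A a ->
    (-1) ^+ s * (a.1 - p.1) < 0 \/ (-1) ^+ t * (a.2 - p.2) < 0.
  move=> Aa; have [x0|] := ltP; first by left.
  have [y0|] := ltP; first by right.
  by move=> y0 x0; case: missed; exists a.
pose h q : R := (-1) ^+ s * q.1 + - (-1) ^+ t * q.2 + ((-1) ^+ t * p.2 - (-1) ^+ s * p.1).
have hc : continuous h by exact: linear_form_continuous.
have nodiag c : A c -> h c = 0 -> False.
  move=> Ac; have [d Ad [cd1 cd2]] := opp _ Ac.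
  have := out _ Ac; have := out _ Ad; rewrite /h => -[] od [] oc; nra.
have [a Aa] := pcA.1; have [b Ab [ab1 ab2]] := opp _ Aa.
have oa := out _ Aa; have ob := out _ Ab.
have [ha|/ltW ha] := leP (h a) 0.
- have hb : 0 <= h b by move: ha; rewrite /h; case: oa; case: ob; nra.
  have [c] := path_connected_IVT pcA hc Aa Ab ha hb; exact: nodiag.
- have hb : h b <= 0 by move: ha; rewrite /h; case: oa; case: ob; nra.
  have [c] := path_connected_IVT pcA hc Ab Aa hb ha; exact: nodiag.
Qed.

Lemma extremal_distance_to (f : set_type A -> R) : extremal f ->
  exists2 p, surrounded A p & distance_to A p = f.
Proof.
move=> ef; have [[_ fd] fmin] := ef; have [a0 Aa0] := pcA.1.
have [p hp] := @manhattan_balls_common_point _ _ f set_val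
  (exist _ a0 (mem_set Aa0)) fd.
have pf : distance_to A p = f by apply: fmin => //; exact: distance_to_admissible.
by exists p => //; apply: extremal_surrounded; rewrite pf.
Qed.

End ManhattanTightSpan.

Theorem corollary2 (R : realType) (A : set (manhattan R))
    (cptA : compact A) (pcA : path_connected A) :
  isometric (set_type (double_hatching A)) (tight_span (set_type A)).
Proof.
have ext (p : set_type (double_hatching A)) :
    extremal (distance_to A (set_val p)).
  apply: distance_to_extremal => a _; apply: surrounded_opposite.
  exact/double_hatching_surrounded/set_mem/valP.
pose F p : tight_span (set_type A) :=
  exist (fun f => f \in [set f | extremal f]) _ (mem_set (ext p)).
have isoF p q : mdist (F p) (F q) = mdist p q.
  apply/eqP; rewrite eq_le; apply/andP; split.
    apply: tight_span_dist_le => [|a]; first exact: mdist_ge0.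
    have := mdist_lipschitz (set_val a) (set_val p) (set_val q).
    rewrite !(metric_sym (set_val a)); exact.
  (* At a point [b] opposite to [p] with respect to [q], the two distance functions differ by
     exactly [mdist p q]. *)
  have [b Ab pqb] := surrounded_opposite (set_val p)
    (double_hatching_surrounded (set_mem (valP q))).
  have -> : mdist p q = `|mdist (set_val p) b - mdist (set_val q) b|.
    by rewrite pqb addrK ger0_norm// mdist_ge0.
  exact: (tight_span_dist_ub (F p) (F q) (exist _ b (mem_set Ab))).
exists F => //; rewrite -setTT_bijective; split => // [p q _ _ Fpq|f _].
  by apply: mdist_positivity; rewrite -isoF Fpq mdistxx.
have [p Ap pf] := extremal_distance_to cptA pcA (tight_span_extremal f).
exists (exist _ p (mem_set (surrounded_double_hatching pcA Ap))) => //.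
exact: val_inj.
Qed.
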